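(* Let $a\in\mathbb{Q}$, let $c=-1+a-a^2$, and let $f(x)=x^2+c$. Write $a=\frac{r}{s}$ where $r,s\in\mathbb{Z}$, $s>0$, and $\gcd(r,s)=1$. Suppose $a-c$ is not a square in $\mathbb{Q}$ and at least one of the following holds: (1) $r=1$ and $s>2$ is even; (2) $r=2$, $s>3$, and $s\equiv 1\pmod 3$; (3) $r=2$ and $s$ is divisible by a prime $q$ with $q\equiv 3\pmod 4$. Then the arboreal Galois representation $\mathrm{Gal}(\bar{\mathbb{Q}}/\mathbb{Q})\to\mathrm{Aut}(T)$ associated to $f$ and $a$ is surjective.
   Context: For $f\in\mathbb{Q}[x]$ of degree $2$ and $a\in\mathbb{Q}$, the backward orbit of $a$ is $\mathcal{O}^-(a)=\{\beta\in\bar{\mathbb{Q}}: f^n(\beta)=a \text{ for some } n\ge 0\}$ ($f^n$ the $n$-th iterate). It is given the structure of a rooted tree $T$: the root is $a$, the vertices at level $n$ are the elements of $f^{-n}(a)$, and there is an edge between $\beta$ and $f(\beta)$; when $a$ is not in the forward orbit of the critical point $0$ this is the complete regular binary rooted tree. The absolute Galois group $\mathrm{Gal}(\bar{\mathbb{Q}}/\mathbb{Q})$ acts on $\mathcal{O}^-(a)$ by tree automorphisms, giving a homomorphism $\mathrm{Gal}(\bar{\mathbb{Q}}/\mathbb{Q})\to\mathrm{Aut}(T)$, the arboreal Galois representation; its image is isomorphic to $\mathrm{Gal}(\mathbb{Q}(\mathcal{O}^-(a))/\mathbb{Q})$. *)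

(* Defs.v *)
From HB Require Import structures.
From mathcomp Require Import all_boot all_order all_algebra all_field.
From mathcomp Require Import boolp classical_sets.

Set Implicit Arguments.
Unset Strict Implicit.
Unset Printing Implicit Defensive.

Import GRing.Theory.
Local Open Scope ring_scope.

(* The algebraic closure of Q is algC. Any ring endomorphism of algC fixes Q and
   is bijective; both conditions are nevertheless recorded explicitly. *)
Record abs_gal := AbsGal {
  gal_fun :> {rmorphism algC -> algC};
  gal_bij : bijective gal_fun;
  gal_fix : forall q : rat, gal_fun (ratr q) = ratr q
}.

Section RootedGraphAutomorphism.
Variables (V : Type) (adj : V -> V -> Prop) (root : V).

Record rooted_aut := RootedAut {
  aut_fun :> V -> V;
  aut_bij : bijective aut_fun;
  aut_adj : forall u v, adj u v <-> adj (aut_fun u) (aut_fun v);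
  aut_root : aut_fun root = root
}.

Lemma rooted_aut_ext (t1 t2 : rooted_aut) : t1 =1 t2 -> t1 = t2.
Proof.
case: t1 t2 => [f1 b1 a1 r1] [f2 b2 a2 r2] /= /funext e.
by case: f2 / e b2 a2 r2 => b2 a2 r2; congr RootedAut; exact: Prop_irrelevance.
Qed.

Lemma comp_aut_subproof (t1 t2 : rooted_aut) u v :
  adj u v <-> adj ((t1 \o t2) u) ((t1 \o t2) v).
Proof. by rewrite (aut_adj t2) (aut_adj t1). Qed.

Lemma comp_root_subproof (t1 t2 : rooted_aut) : (t1 \o t2) root = root.
Proof. by rewrite /= !aut_root. Qed.

Definition comp_aut (t1 t2 : rooted_aut) : rooted_aut :=
  RootedAut (bij_comp (aut_bij t1) (aut_bij t2)) (comp_aut_subproof t1 t2)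
            (comp_root_subproof t1 t2).

End RootedGraphAutomorphism.

Section ArborealRepresentation.
Variables (f : {poly rat}) (a : rat).

Definition evalC (z : algC) : algC := (map_poly ratr f).[z].

Definition backward_orbit : set algC :=
  [set b | exists n : nat, iter n evalC b = ratr a]%classic.

Definition vertex : Type := set_type backward_orbit.

Lemma root_subproof : (ratr a : algC) \in backward_orbit.
Proof. by apply: mem_set; exists 0%N. Qed.

Definition root_vertex : vertex := exist _ (ratr a) root_subproof.

(* Edges join b and f(b). This is a tree rooted at a as soon as a is not
   periodic under f; in general only a graph with a base point. *)
Definition adjacent (u v : vertex) : Prop :=
  evalC (val u) = val v \/ evalC (val v) = val u.

Definition aut_tree : Type := rooted_aut adjacent root_vertex.

Lemma gal_evalC (s : abs_gal) z : s (evalC z) = evalC (s z).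
Proof.
rewrite /evalC -horner_map /= -map_poly_comp; congr (_.[_]).
by apply: eq_map_poly => q /=; exact: gal_fix.
Qed.

Lemma gal_iter (s : abs_gal) n z : s (iter n evalC z) = iter n evalC (s z).
Proof. by elim: n => //= n IHn; rewrite gal_evalC IHn. Qed.

Lemma gal_orbit (s : abs_gal) z : (s z \in backward_orbit) = (z \in backward_orbit).
Proof.
apply/idP/idP => /set_mem[n hn]; apply: mem_set; exists n.
  by apply: (bij_inj (gal_bij s)); rewrite gal_iter hn gal_fix.
by rewrite -gal_iter hn gal_fix.
Qed.

Lemma gal_vertex_subproof (s : abs_gal) (v : vertex) : s (val v) \in backward_orbit.
Proof. by rewrite gal_orbit; exact: (valP v). Qed.

Definition gal_vertex (s : abs_gal) (v : vertex) : vertex :=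
  exist _ (s (val v)) (gal_vertex_subproof s v).

Lemma gal_vertex_bij (s : abs_gal) : bijective (gal_vertex s).
Proof.
have [g sK gK] := gal_bij s.
have gO (v : vertex) : g (val v) \in backward_orbit.
  by rewrite -(gal_orbit s) gK; exact: (valP v).
exists (fun v => exist _ (g (val v)) (gO v) : vertex) => v; apply: val_inj => /=.
  exact: sK.
exact: gK.
Qed.

Lemma gal_vertex_adj (s : abs_gal) u v :
  adjacent u v <-> adjacent (gal_vertex s u) (gal_vertex s v).
Proof.
rewrite /adjacent /= -!gal_evalC; split; case => h.
- by left; rewrite h.
- by right; rewrite h.
- by left; apply: (bij_inj (gal_bij s)).
- by right; apply: (bij_inj (gal_bij s)).
Qed.

Lemma gal_vertex_root (s : abs_gal) : gal_vertex s root_vertex = root_vertex.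
Proof. by apply: val_inj; exact: gal_fix. Qed.

Definition arboreal_rep (s : abs_gal) : aut_tree :=
  RootedAut (gal_vertex_bij s) (gal_vertex_adj s) (gal_vertex_root s).

Lemma arboreal_rep_comp (s1 s2 s : abs_gal) : s =1 s1 \o s2 ->
  arboreal_rep s = comp_aut (arboreal_rep s1) (arboreal_rep s2).
Proof. by move=> e; apply: rooted_aut_ext => v; apply: val_inj; exact: e. Qed.

End ArborealRepresentation.

(* Main.v *)
Require Import Defs.
From HB Require Import structures.
From mathcomp Require Import all_boot all_order all_algebra all_field.
From mathcomp Require Import boolp classical_sets filter.
From mathcomp Require Import zify ring lra.

Set Implicit Arguments.
Unset Strict Implicit.
Unset Printing Implicit Defensive.

Import Order.TTheory GRing.Theory Num.Theory.
Local Open Scope ring_scope.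

(* Level [n+1] of the tree is obtained from level [n] by adjoining the square
   roots of [b - c], [b] running over level [n], so surjectivity means that these
   numbers are independent modulo squares in the field of level [n]. The set of
   relations is stable under Galois; if it is nonzero it contains the relation
   involving all [b], because the lower levels already realise every tree
   automorphism. As the product of the [b - c] is, up to sign, the rational number
   [f^(n+1)(0) - a], Kummer theory descends such a relation to one between the
   numbers [f^(i+1)(0) - a], [i <= n], modulo squares in [Q].

   Since [a] is preperiodic ([a], [a - 1], [- a], [a - 1], ...), the numerators of
   these numbers share no odd prime; their 2-adic valuations are even, and they
   are negative for [i > 0]. A relation would thus force some numerator to be
   minus a square, which fails modulo 4, 3 or [q]. All Galois groups are replaced
   by groups of automorphisms of [algC]; the automorphisms found for the finite
   levels are glued along an ultrafilter. *)

(** * Automorphisms of the algebraic numbers *)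

Local Notation autC := {rmorphism algC -> algC}.

(** The minimal polynomial of [x] over the rationals is ['X^2 - q], so sending [x] to [- x] defines
    an endomorphism of the number field generated by [x], which extends to [algC]. *)
Lemma sqrt_rat_conj (x : algC) (q : rat) :
  x ^+ 2 = ratr q -> x \notin Crat -> exists nu : autC, nu x = - x.
Proof.
move=> x2 xQ.
have [Qs [QsC [[|z []] // [Dz]]] genQs] := num_field_exists [:: x].
have hom1 : kHom 1 1 (\1%VF : 'End(Qs)) by rewrite kHom1.
pose p : {poly Qs} := 'X^2 - (q%:A)%:P.
have z2 : z ^+ 2 = q%:A.
  apply: (fmorph_inj QsC); rewrite rmorphXn /= Dz x2 alg_num_field.
  by rewrite fmorph_rat.
have sp : size p = 3%N by rewrite size_XnsubC.
have pz : root p z by rewrite /root !hornerE z2 subrr.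
have pK : p \is a polyOver 1%VS.
  by rewrite rpredB ?rpredX ?polyOverX ?polyOverC ?memvZ ?mem1v.
have zN1 : z \notin 1%VS.
  apply: contra xQ => /vlineP[k zk].
  by rewrite -Dz zk alg_num_field fmorph_rat Crat_rat.
have rN : root (map_poly \1%VF (minPoly 1 z)) (- z).
  rewrite lfun1_poly.
  have dv : minPoly 1 z %| p by exact: minPoly_dvdp.
  have pE : minPoly 1 z %= p.
    rewrite -(dvdp_size_eqp dv) sp size_minPoly eqSS.
    rewrite eqn_leq; apply/andP; split.
      have := dvdp_leq _ dv; rewrite size_minPoly sp ltnS; apply.
      by rewrite -size_poly_gt0 sp.
    by rewrite ltn_neqAle eq_sym adjoin_deg_eq1 zN1 lt0n.
  by rewrite (eqp_root pE) /root !hornerE sqrrN z2 subrr.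
pose phi := kHomExtend 1 \1 z (- z).
have phim : monoid_morphism phi.
  by apply/kHom_monoid_morphism; rewrite -genQs span_seq1 /= kHomExtendP.
pose phimM := GRing.isMonoidMorphism.Build _ _ phi phim.
pose phiRM : {rmorphism _ -> _} := HB.pack (fun_of_lfun phi) phimM.
have [nu Dnu] := extend_algC_subfield_aut QsC phiRM.
by exists nu; rewrite -Dz -Dnu /= (kHomExtend_val hom1) // rmorphN.
Qed.

Lemma aut_fixed_sqrt_rat (x : algC) (q : rat) :
  x ^+ 2 = ratr q -> (forall nu : autC, nu x = x) -> x \in Crat.
Proof.
move=> x2 fx; apply: contraT => xQ.
have [nu nux] := sqrt_rat_conj x2 xQ.
have /eqP := nux; rewrite fx -subr_eq0 opprK -mulr2n mulrn_eq0 /= => /eqP x0.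
by rewrite x0 rpred0 in xQ.
Qed.

(** Linear algebra over F_2: the sign character of [y] on [H] is trivial on the common kernel of the
    characters of the [g b], so it is a sum of some of them. The induction replaces [H] by the
    stabiliser of [g b0] in [H]. *)
Lemma kummer_fixed (T : eqType) (g : T -> algC) (L : seq T)
    (H : autC -> Prop) (y : algC) :
  (forall s t : autC, H s -> H t -> H (s \o t)) -> uniq L ->
  (forall s b, H s -> b \in L -> s (g b) = g b \/ s (g b) = - g b) ->
  (forall s, H s -> s y = y \/ s y = - y) ->
  (forall s : autC, H s -> {in L, forall b, s (g b) = g b} -> s y = y) ->
  exists J : pred T, forall s, H s ->
    s (y * \prod_(b <- L | J b) g b) = y * \prod_(b <- L | J b) g b.
Proof.
elim: L H => [|b0 L IH] H Hc /=.
  by move=> _ _ _ fy; exists pred0 => s Hs; rewrite big_nil mulr1 fy.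
move=> /andP[b0L uL] sg sy fy.
have sgL s b : H s -> b \in L -> s (g b) = g b \/ s (g b) = - g b.
  by move=> Hs bL; apply: sg => //; rewrite inE bL orbT.
have sgb s : H s -> s (g b0) = g b0 \/ s (g b0) = - g b0.
  by move=> Hs; apply: sg => //; rewrite inE eqxx.
have [|||||J fJ] := IH (fun s => H s /\ s (g b0) = g b0) => //.
- by move=> s t [Hs sb] [Ht tb]; split; [exact: Hc|rewrite /= tb sb].
- by move=> s b [Hs _]; exact: sgL.
- by move=> s [Hs _]; exact: sy.
- move=> s [Hs sb] fL; apply: fy => // b; rewrite inE => /predU1P[->//|].
  exact: fL.
set y' := y * _ in fJ.
have prodE c : y * \prod_(b <- b0 :: L | if b == b0 then c else J b) g b =
    if c then y' * g b0 else y'.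
  rewrite big_cons eqxx.
  have -> : \prod_(b <- L | if b == b0 then c else J b) g b =
            \prod_(b <- L | J b) g b.
    rewrite big_seq_cond [RHS]big_seq_cond; apply: eq_bigl => b.
    by case: (eqVneq b b0) => // ->; rewrite (negPf b0L).
  by case: c => //; rewrite mulrCA mulrC.
have sy' s : H s -> s y' = y' \/ s y' = - y'.
  move=> Hs; rewrite /y' rmorphM rmorph_prod /= big_seq_cond.
  rewrite [\prod_(b <- L | J b) g b]big_seq_cond.
  elim/big_rec2: _ => [|b p1 p2 /andP[bL _]]; first by rewrite !mulr1; exact: sy.
  rewrite mulrCA [y * (_ * _)]mulrCA => -[] ->; case: (sgL s b Hs bL) => ->.
  - by left.
  - by right; rewrite mulNr.
  - by right; rewrite mulrN.
  - by left; rewrite mulrNN.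
case: (pselect (forall s, H s -> s y' = y')) => [fy'|].
  by exists (fun b => if b == b0 then false else J b) => s Hs; rewrite prodE fy'.
move=> /existsNP[t0 /not_implyP[Ht0 t0y]].
have {}t0y : t0 y' = - y' by case: (sy' _ Ht0).
exists (fun b => if b == b0 then true else J b) => s Hs; rewrite prodE.
rewrite rmorphM; case: (sgb s Hs) => sb.
  by rewrite sb fJ.
(* If [t0] fixes [g b0], it fixes [y'] as well, so [y' = - y'] and signs do not matter. Otherwise
   [t0 \o s] fixes [g b0], hence [y'], so [s] negates [y'] together with [g b0]. *)
case: (sgb t0 Ht0) => t0b.
  have y0 : y' = - y' by rewrite -{1}t0y fJ.
  by case: (sy' _ Hs) => ->; rewrite sb ?mulrNN // mulrN -mulNr -y0.
have /fJ /= : H (t0 \o s) /\ t0 (s (g b0)) = g b0.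
  by split; [exact: Hc | rewrite sb rmorphN t0b opprK].
case: (sy' _ Hs) => -> e; rewrite sb ?mulrNN // mulrN -mulNr.
by rewrite t0y in e; rewrite e.
Qed.

Lemma ultra_finite_value (T : eqType) (U : set_system nat) (h : nat -> T)
    (l : seq T) : UltraFilter U -> (forall n, h n \in l) ->
  exists w, U [set n | h n = w]%classic.
Proof.
move=> UU hl; have : U [set n | h n \in l]%classic.
  by apply: filterS filterT => n _ /=.
elim: l {hl} => [|w l IH] Ul; first by have [n] := filter_ex Ul.
case: (in_ultra_setVsetC [set n | h n = w]%classic UU) => [|Uw]; first by exists w.
apply: IH; apply: filterS (filterI Ul Uw) => n /= [].
by rewrite inE => /predU1P[hw /(_ hw)|].
Qed.

(* Each [sg n z] is one of the finitely many conjugates of [z], so it is constant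
   along an ultrafilter. *)
Lemma aut_ultralimit (sg : nat -> autC) : exists g : autC, forall z w N,
  (forall n, (N <= n)%N -> sg n z = w) -> g z = w.
Proof.
(* [U] refines the filter of cofinite sets, so the limit along [U] agrees with any eventually
   constant value. *)
have [U [UU sU]] := ultraFilterLemma (eventually_filter).
have gP z : exists w, U [set n | sg n z = w]%classic.
  have [l Dl] := closed_field_poly_normal (minCpoly z).
  apply: (@ultra_finite_value _ _ _ l) => // n; rewrite -root_prod_XsubC.
  have := root_minCpoly (sg n z); rewrite minCpoly_aut {1}Dl rootZ //.
  by rewrite lead_coef_eq0 minCpoly_eq0.
have [g {}gP] := choice gP.
have gU z w : U [set n | sg n z = w]%classic -> g z = w.
  by move=> Uw; have [n /= [<- <-]] := filter_ex (filterI (gP z) Uw).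
have gB : zmod_morphism g.
  move=> x y; apply: gU; apply: filterS (filterI (gP x) (gP y)) => n /= [<- <-].
  by rewrite rmorphB.
have gM : monoid_morphism g.
  split; first by apply: gU; apply: filterS filterT => n _ /=; rewrite rmorph1.
  move=> x y; apply: gU; apply: filterS (filterI (gP x) (gP y)) => n /= [<- <-].
  by rewrite rmorphM.
pose gBM := GRing.isZmodMorphism.Build _ _ g gB.
pose gMM := GRing.isMonoidMorphism.Build _ _ g gM.
pose gRM : autC := HB.pack g gBM gMM.
by exists gRM => z w N sgw; apply: gU; apply: sU; exists N.
Qed.

(** * The tree of iterated preimages *)

Lemma big_addb_eq (T : eqType) (L : seq T) (J F : pred T) b0 :
  uniq L -> b0 \in L -> {in L, forall b, F b = (b == b0)} ->
  \big[addb/false]_(b <- L | J b) F b = J b0.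
Proof.
move=> uL b0L FE; rewrite big_mkcond (bigD1_seq b0) //= FE // eqxx.
rewrite big1_seq ?addbF //; first by case: (J b0).
by move=> b /andP[/negPf bb0 bL]; rewrite FE // bb0; case: ifP.
Qed.

Section QuadraticTree.

Variables a c : rat.

Definition fC (z : algC) : algC := z ^+ 2 + ratr c.

(** A fixed choice of preimage of [b] under [fC]; the other one is [- gam b]. *)
Definition gam (b : algC) : algC := sqrtC (b - ratr c).

Fixpoint level n : seq algC :=
  if n is m.+1 then
    [seq gam b | b <- level m] ++ [seq - gam b | b <- level m]
  else [:: ratr a].

(** This is [f^(n+1)(0)]: the orbit starts at the critical value, not at the critical point. *)
Definition crit n : rat := iter n (fun x => x ^+ 2 + c) c.

Arguments crit : simpl never.

(** Up to squares, the discriminant of [f^(n+1) - a]. The sign differs at [0] because only level [0]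
    has an odd number of vertices. *)
Definition disc n : rat := if n is 0%N then a - c else crit n - a.

Definition disc_root n : algC := \prod_(b <- level n) gam b.

Lemma fC_gam b : fC (gam b) = b.
Proof. by rewrite /fC sqrtCK subrK. Qed.

Lemma fCN z : fC (- z) = fC z.
Proof. by rewrite /fC sqrrN. Qed.

Lemma gam_inj : injective gam.
Proof. exact: can_inj fC_gam. Qed.

Lemma fC_eq x y : fC x = fC y -> x = y \/ x = - y.
Proof.
by move/addIr/eqP; rewrite eqf_sqr => /orP[] /eqP->; [left|right].
Qed.

Lemma gam_fC x : x = gam (fC x) \/ x = - gam (fC x).
Proof. by apply: fC_eq; rewrite fC_gam. Qed.

Lemma mem_levelS n x : (x \in level n.+1) = (fC x \in level n).
Proof.
rewrite /= mem_cat; apply/orP/idP => [[] /mapP[b bL ->]|fL].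
- by rewrite fC_gam.
- by rewrite fCN fC_gam.
case: (gam_fC x) => ->; [left|right]; first exact: map_f.
exact: (map_f (fun b => - gam b)).
Qed.

Lemma mem_level n x : (x \in level n) = (iter n fC x == ratr a).
Proof.
elim: n x => [|n IH] x; first by rewrite inE.
by rewrite mem_levelS IH iterSr.
Qed.

Lemma mem_gam n b : b \in level n -> gam b \in level n.+1.
Proof. by rewrite mem_levelS fC_gam. Qed.

Lemma mem_levelN n x : (- x \in level n.+1) = (x \in level n.+1).
Proof. by rewrite !mem_levelS fCN. Qed.

Lemma iter_level k m b : b \in level (m + k) -> iter m fC b \in level k.
Proof. by rewrite !mem_level addnC iterD. Qed.

(** Opposite roots pair up: [(x - gam b) * (x + gam b) = fC x - b]. *)
Lemma prod_level n x : \prod_(b <- level n) (x - b) = iter n fC x - ratr a.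
Proof.
elim: n x => [|n IH] x; first by rewrite big_seq1.
rewrite iterSr -IH /= big_cat /= !big_map -big_split /=; apply: eq_bigr => b _.
by rewrite opprK -subr_sqr sqrtCK opprB addrA /fC.
Qed.

Lemma size_level n : size (level n) = (2 ^ n)%N.
Proof.
by elim: n => //= n IH; rewrite size_cat !size_map IH addnn -mul2n expnS.
Qed.

Lemma ratr_crit n : ratr (crit n) = iter n fC (ratr c).
Proof. by elim: n => //= n <-; rewrite /fC -rmorphXn -rmorphD. Qed.

(** This is [prod_level] at the critical value [c]; the signs cancel on every level with evenly many
    vertices. *)
Lemma disc_rootX2 n : disc_root n ^+ 2 = ratr (disc n).
Proof.
rewrite -prodrXl; under eq_bigr do rewrite sqrtCK.
case: n => [|n]; first by rewrite big_seq1 rmorphB.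
have := prod_level n.+1 (ratr c); have := size_level n.+1.
move: (level n.+1) => L sL pL; rewrite /disc rmorphB /= ratr_crit -pL.
under eq_bigr do rewrite -opprB -mulN1r.
rewrite big_split /= big_const_seq count_predT iter_mulr_1 sL.
by rewrite expnS exprM sqrrN !expr1n mul1r.
Qed.

(** * Action of automorphisms on the levels, and Kummer signs *)

Section Automorphisms.

Implicit Types s t : autC.

Lemma aut_fC s x : s (fC x) = fC (s x).
Proof. by rewrite /fC rmorphD rmorphXn /= fmorph_rat. Qed.

Lemma aut_iter s m x : s (iter m fC x) = iter m fC (s x).
Proof. by elim: m => //= m <-; rewrite aut_fC. Qed.

Lemma aut_level s n x : (s x \in level n) = (x \in level n).
Proof.
rewrite !mem_level -aut_iter -[in LHS](fmorph_rat s a) (inj_eq _) //.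
exact: fmorph_inj.
Qed.

Lemma aut_gam s b : s (gam b) = gam (s b) \/ s (gam b) = - gam (s b).
Proof. by apply: fC_eq; rewrite -aut_fC !fC_gam. Qed.

Definition fixes n s := {in level n, forall b, s b = b}.

Definition aut_conj s t : autC := s \o (t \o algC_invaut s).

(** The Kummer sign of [s] at [b] as a bit, additive in [s] among the automorphisms fixing the level
    of [b]. *)
Definition neg s b : bool := s (gam b) != gam b.

Lemma fixes0 s : fixes 0 s.
Proof. by move=> b; rewrite inE => /eqP->; rewrite fmorph_rat. Qed.

Lemma fixes_comp n s t : fixes n s -> fixes n t -> fixes n (s \o t).
Proof. by move=> fs ft b bL /=; rewrite ft ?fs. Qed.

Lemma fixes_conj n s t : fixes n t -> fixes n (aut_conj s t).
Proof.
by move=> ft b bL /=; rewrite ft ?algC_invautK // -(aut_level s) algC_invautK.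
Qed.

Lemma fixesS n s :
  fixes n s -> {in level n, forall b, s (gam b) = gam b} -> fixes n.+1 s.
Proof.
move=> fs fg x xL; rewrite mem_levelS in xL.
by case: (gam_fC x) => ->; rewrite ?rmorphN /= fg.
Qed.

Lemma neg_sign n s b : fixes n s -> b \in level n ->
  s (gam b) = (-1) ^+ neg s b * gam b.
Proof.
move=> fs bL; rewrite /neg; case: eqP => [->|/eqP ne]; first by rewrite mul1r.
by case: (aut_gam s b) ne => ->; rewrite fs ?eqxx // mulN1r.
Qed.

Lemma neg_prod n s (J : pred algC) : fixes n s ->
  s (\prod_(b <- level n | J b) gam b) =
  (-1) ^+ (\big[addb/false]_(b <- level n | J b) neg s b) *
    \prod_(b <- level n | J b) gam b.
Proof.
move=> fs; rewrite rmorph_prod /= big_seq_cond.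
rewrite [in X in _ = (-1) ^+ X * _]big_seq_cond [in X in _ = _ * X]big_seq_cond.
elim/big_rec3: _ => [|b p e q /andP[bL _] ->]; first by rewrite mulr1.
by rewrite (neg_sign fs bL) signr_addb mulrACA.
Qed.

End Automorphisms.

Hypothesis disc_neq0 : forall n, disc n != 0.

Lemma disc_root_neq0 n : disc_root n != 0.
Proof.
have : disc_root n ^+ 2 != 0 by rewrite disc_rootX2 fmorph_eq0.
by rewrite expf_eq0.
Qed.

Lemma gam_neq0 n b : b \in level n -> gam b != 0.
Proof.
move=> bL; have := disc_root_neq0 n; apply: contra => /eqP b0.
by apply/eqP; rewrite /disc_root (big_rem b) //= b0 mul0r.
Qed.

Lemma gam_neqN n b : b \in level n -> (- gam b == gam b) = false.
Proof.
by move=> bL; rewrite eq_sym -subr_eq0 opprK -mulr2n mulrn_eq0 (negPf (gam_neq0 bL)).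
Qed.

Lemma level_uniq n : uniq (level n).
Proof.
elim: n => //= n IH; rewrite cat_uniq map_inj_uniq ?IH /=; last exact: gam_inj.
rewrite map_inj_uniq ?IH ?andbT; last by move=> x y /oppr_inj/gam_inj.
apply/hasPn => _ /mapP[b bL ->]; apply/mapP => -[b' _ e].
have eb : b' = b by rewrite -[b']fC_gam -e fCN fC_gam.
by have := gam_neqN bL; rewrite e eb eqxx.
Qed.

Lemma perm_aut_level (s : autC) n : perm_eq [seq s b | b <- level n] (level n).
Proof.
have us : uniq [seq s b | b <- level n].
  by rewrite map_inj_uniq ?level_uniq //; exact: fmorph_inj.
apply: uniq_perm => //; first exact: level_uniq.
have sub : {subset [seq s b | b <- level n] <= level n}.
  by move=> _ /mapP[b bL ->]; rewrite aut_level.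
by have [] := uniq_min_size us sub; rewrite ?size_map.
Qed.

Lemma neg_comp n (s t : autC) b : fixes n s -> fixes n t -> b \in level n ->
  neg (s \o t) b = neg s b (+) neg t b.
Proof.
move=> fs ft bL; rewrite {1}/neg /= (neg_sign ft bL) rmorphM rmorph_sign /=.
rewrite (neg_sign fs bL) mulrA -signr_addb addbC.
by case: addb; rewrite ?mul1r ?eqxx // mulN1r (gam_neqN bL).
Qed.

(** [s (gam b)] is [gam (s b)] up to sign, and whether a square root gets negated does not depend on
    the choice of the root. *)
Lemma neg_conj n (s t : autC) b : fixes n t -> b \in level n ->
  neg (aut_conj s t) (s b) = neg t b.
Proof.
move=> ft bL; rewrite /neg /=.
have [e ->] : exists e : bool, gam (s b) = s ((-1) ^+ e * gam b).
  case: (aut_gam s b) => e; [exists false|exists true]; first by rewrite mul1r.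
  by rewrite mulN1r rmorphN /= e opprK.
rewrite algC_autK (inj_eq (fmorph_inj s)) rmorphM rmorph_sign.
by rewrite (inj_eq (mulfI _)) // signr_eq0.
Qed.

Definition flip n b (t : autC) :=
  fixes n t /\ {in level n, forall b', neg t b' = (b' == b)}.

(** Independence of the numbers [b - c] modulo squares in the field of level [n], expressed on the
    Galois side by a dual basis. *)
Definition independent n := forall b, b \in level n -> exists t, flip n b t.

Lemma flip_levelS n b t x : flip n b t -> x \in level n.+1 ->
  t x = if fC x == b then - x else x.
Proof.
move=> [ft nt]; rewrite mem_levelS => xL.
have : t (gam (fC x)) = if fC x == b then - gam (fC x) else gam (fC x).
  by rewrite (neg_sign ft xL) nt //; case: ifP; rewrite ?mulN1r ?mul1r.
by move=> e; case: (gam_fC x) => {1 3 4}->; rewrite ?rmorphN /= e; case: ifP.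
Qed.

(** Once the parents are matched by induction, the images can differ only by a sign, which a flip at
    the parent corrects. *)
Lemma level_transitive n b b' : (forall k, (k < n)%N -> independent k) ->
  b \in level n -> b' \in level n -> exists s : autC, s b = b'.
Proof.
elim: n b b' => [|n IH] b b' ind.
  by rewrite !inE => /eqP-> /eqP->; exists idfun.
move=> bL b'L; have fb'L := b'L; rewrite mem_levelS in fb'L.
have [|||s sb] := IH (fC b) (fC b') => //; first by move=> k /ltnW; exact: ind.
  by rewrite -mem_levelS.
have /fC_eq[] : fC (s b) = fC b' by rewrite -aut_fC.
  by exists s.
have [t tf] := ind n (ltnSn n) _ fb'L.
move=> sbb'; exists (t \o s); rewrite /= sbb'.
by rewrite (flip_levelS tf) ?mem_levelN // fCN eqxx opprK.
Qed.

Lemma aut_sqrt_rat (s : autC) x q : x ^+ 2 = ratr q -> s x = x \/ s x = - x.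
Proof.
move=> x2; have /eqP : (s x) ^+ 2 = x ^+ 2 by rewrite -rmorphXn /= x2 fmorph_rat.
by rewrite eqf_sqr => /orP[] /eqP->; [left|right].
Qed.

(* Kummer theory over the field of level [n] gives a set [J] of vertices, which
   is invariant under the transitive Galois action, hence empty or full. *)
Lemma sqrt_rat_level_step n x q : (forall k, (k <= n)%N -> independent k) ->
  x ^+ 2 = ratr q -> (forall s, fixes n.+1 s -> s x = x) ->
  (forall s, fixes n s -> s x = x) \/
  (forall s, fixes n s -> s (x * disc_root n) = x * disc_root n).
Proof.
move=> ind x2 fx; have [->|x0] := eqVneq x 0.
  by left => s _; rewrite rmorph0.
have [||||| J fJ] := @kummer_fixed _ gam (level n) (fixes n) x.
- exact: fixes_comp.
- exact: level_uniq.
- by move=> s b fs bL; have := aut_gam s b; rewrite (fs b bL).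
- by move=> s _; exact: aut_sqrt_rat x2.
- by move=> s fs fg; apply: fx; exact: fixesS.
have signx s : fixes n s ->
    s x = (-1) ^+ (\big[addb/false]_(b <- level n | J b) neg s b) * x.
  move=> fs; have := fJ s fs; rewrite rmorphM /= (neg_prod _ fs).
  set e := \big[_/_]_(_ <- _ | _) _; set P := \prod_(_ <- _ | _) _.
  have P0 : P != 0.
    rewrite /P prodf_seq_neq0; apply/allP => b bL.
    by rewrite (gam_neq0 bL) implybT.
  rewrite mulrA => /(mulIf P0) {2}<-.
  by rewrite mulrCA -signr_addb addbb mulr1.
(* Conjugating the flip at [b] by an [s] with [s b = b'] gives the flip at [b']; their signs on [x]
   are [J b] and [J b']. *)
have Jconst : {in level n &, forall b b', J b = J b'}.
  move=> b b' bL b'L.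
  have [|s sb] := @level_transitive n b b' _ bL b'L.
    by move=> k /ltnW; exact: ind.
  have [t [ft nt]] := ind n (leqnn n) b bL.
  have := signx _ (fixes_conj s ft).
  (* Both [s] and [t] act on [x] by a sign, so they commute there. *)
  have -> : aut_conj s t x = t x.
    have [e sx] : exists e : bool, s x = (-1) ^+ e * x.
      case: (aut_sqrt_rat s x2) => ->; [exists false|exists true].
        by rewrite mul1r.
      by rewrite mulN1r.
    have -> : t x = (-1) ^+ e * s (t x).
      have [d tx] : exists d : bool, t x = (-1) ^+ d * x.
        by eexists; exact: signx.
      by rewrite tx rmorphM rmorph_sign /= sx mulrCA signrMK.
    have sx' : algC_invaut s x = (-1) ^+ e * x.
      by rewrite -[in RHS](algC_autK s x) sx rmorphM rmorph_sign signrMK.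
    by rewrite /= sx' !rmorphM !rmorph_sign.
  rewrite (signx _ ft) => /(mulIf x0)/signr_inj.
  have uL := level_uniq n.
  rewrite (big_addb_eq _ uL bL nt) (big_addb_eq _ uL b'L) // => b2 b2L.
  have b2E : b2 = s (algC_invaut s b2) by rewrite algC_invautK.
  have b2L' : algC_invaut s b2 \in level n by rewrite aut_level.
  rewrite {1}b2E (neg_conj _ ft) // nt // -sb b2E.
  by rewrite (inj_eq (fmorph_inj s)) algC_autK.
have [b0 b0L] : exists b0, b0 \in level n.
  have : (0 < size (level n))%N by rewrite size_level expn_gt0.
  by case: (level n) => // b L _; exists b; rewrite mem_head.
case Jb0 : (J b0); [right|left] => s fs.
  have := fJ s fs; rewrite /disc_root big_seq_cond.
  rewrite [\prod_(b <- level n) _]big_seq_cond.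
  rewrite (eq_bigl (fun b => (b \in level n) && true)) // => b.
  by case bL: (b \in level n); rewrite //= (Jconst b b0).
have := fJ s fs; rewrite big_seq_cond big_pred0 ?mulr1 // => b.
by case bL: (b \in level n); rewrite //= (Jconst b b0).
Qed.

(** Descent through the levels: at each one [x], possibly after multiplication by [disc_root],
    already lies in the field of the level below. At level [0] every automorphism fixes the product,
    which is then rational. *)
Lemma sqrt_rat_level n x q : (forall k, (k < n)%N -> independent k) ->
  x ^+ 2 = ratr q -> (forall s, fixes n s -> s x = x) ->
  exists I : pred nat, x * \prod_(i < n | I i) disc_root i \in Crat.
Proof.
elim: n x q => [|n IH] x q ind x2 fx.
  exists pred0; rewrite big_pred0 // mulr1; apply: aut_fixed_sqrt_rat x2 _ => s.
  by apply: fx; exact: fixes0.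
have ind' k : (k < n)%N -> independent k by move=> /ltnW; exact: ind.
have extend (I : pred nat) (d : bool) :
    \prod_(i < n.+1 | if i == n :> nat then d else I i) disc_root i =
    (\prod_(i < n | I i) disc_root i) * (if d then disc_root n else 1).
  rewrite big_mkcond big_ord_recr /= eqxx; congr (_ * _).
  rewrite [RHS]big_mkcond; apply: eq_bigr => i _.
  by rewrite ltn_eqF.
case: (sqrt_rat_level_step ind x2 fx) => {}fx.
  have [I xI] := IH x q ind' x2 fx.
  exists (fun i => if i == n then false else I i).
  by rewrite (extend I false) mulr1.
have [||I xI] := IH (x * disc_root n) (q * disc n) ind'.
- by rewrite exprMn x2 disc_rootX2 rmorphM.
- exact: fx.
exists (fun i => if i == n then true else I i).
by rewrite (extend I true) [_ * disc_root n]mulrC mulrA.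
Qed.

(** By [neg_prod], this says that the product of the [gam b] over [J] is fixed by all automorphisms
    fixing level [n]: a relation modulo squares, written additively. *)
Definition annihilates n (J : pred algC) := forall s, fixes n s ->
  \big[addb/false]_(b <- level n | J b) neg s b = false.

Lemma annihilates_eq n (J K : pred algC) : {in level n, J =1 K} ->
  annihilates n J -> annihilates n K.
Proof.
move=> JK aJ s fs; apply: etrans (aJ s fs); rewrite big_seq_cond [RHS]big_seq_cond.
by apply: eq_bigl => b; case bL: (b \in level n); rewrite //= JK.
Qed.

Lemma annihilates_add n (J K : pred algC) : annihilates n J ->
  annihilates n K -> annihilates n (fun b => J b (+) K b).
Proof.
move=> aJ aK s fs.
transitivity ((\big[addb/false]_(b <- level n | J b) neg s b) (+)
              (\big[addb/false]_(b <- level n | K b) neg s b)); last first.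
  by rewrite aJ ?aK.
rewrite big_mkcond [X in _ = X (+) _]big_mkcond [X in _ = _ (+) X]big_mkcond /=.
rewrite -big_split /=; apply: eq_bigr => b _.
by case: (J b); case: (K b); case: (neg s b).
Qed.

(** The automorphisms fixing a level are stable under conjugation, and conjugating by [s] moves the
    sign at [b] to [s b]. *)
Lemma annihilates_aut n (J : pred algC) (s : autC) : annihilates n J ->
  annihilates n (fun b => J (s b)).
Proof.
move=> aJ t ft; apply: etrans (aJ _ (fixes_conj s ft)).
rewrite -[RHS](perm_big _ (perm_aut_level s n)) big_map.
rewrite big_seq_cond [RHS]big_seq_cond; apply: eq_bigr => b /andP[bL _].
by rewrite (neg_conj _ ft).
Qed.

(* A nonempty annihilator is pushed down the tree: either it is symmetric under
   negation, hence pulled back from one level below, or adding its translate by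
   a flip makes it so. *)
Lemma annihilates_predT m k (K : pred algC) u :
  (forall i, (i < k)%N -> independent i) ->
  u \in level k -> K u -> annihilates (m + k) (fun b => K (iter m fC b)) ->
  annihilates (m + k) predT.
Proof.
elim: k m K u => [|k IH] m K u ind uL Ku aK.
  apply: annihilates_eq aK => b /iter_level; move: uL.
  by rewrite !inE => /eqP <- /eqP->; rewrite Ku.
have ind' i : (i < k)%N -> independent i by move=> /ltnW; exact: ind.
rewrite addnS -addSn in aK *.
have mL b : b \in level (m.+1 + k) -> iter m fC b \in level k.+1.
  by rewrite addSn -addnS; exact: iter_level.
case: (pselect {in level k.+1, forall w, K (- w) = K w}) => [KN|].
  have gK : {in level k.+1, forall w, K (gam (fC w)) = K w}.
    by move=> w wL; case: (gam_fC w) => [<-//|e]; rewrite -[gam _]opprK -e KN.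
  apply: (IH _ (fun v => K (gam v)) (fC u)) => //; first by rewrite -mem_levelS.
    by rewrite gK.
  by apply: annihilates_eq aK => b bL; rewrite /= gK // mL.
move=> /existsNP[w /not_implyP[wL /eqP KN]].
have fwL : fC w \in level k by rewrite -mem_levelS.
(* The flip [t] exchanges [w] and [- w] and fixes the rest of level [k.+1]. As [K] separates these
   two, adding to [K] its translate by [t] leaves the indicator of the pair, pulled back from
   [fC w]. *)
have [t tf] := ind k (ltnSn k) _ fwL.
apply: (IH _ (pred1 (fC w)) (fC w)) => //=.
apply: annihilates_eq (annihilates_add aK (annihilates_aut t aK)) => b bL /=.
rewrite -aut_iter (flip_levelS tf) ?mL //.
move: (iter m fC b) => x; case: eqP => [/fC_eq[]->|_]; last by rewrite addbb.
  by move: KN; case: (K w); case: (K (- w)).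
by move: KN; rewrite opprK; case: (K w); case: (K (- w)).
Qed.

Hypothesis disc_nonsquare : forall n (I : pred nat) z,
  disc n * \prod_(i < n | I i) disc i != z ^+ 2.

(** Without a flip at [b0], [gam b0] is fixed as soon as the other [gam b] are, so Kummer theory
    yields a relation containing [b0]. It propagates to the whole level, so [disc_root n] lies in
    the field of level [n], and the descent gives a forbidden square. *)
Lemma level_independent n : independent n.
Proof.
elim/ltn_ind: n => n ind b0 b0L; apply: contrapT => /forallNP noflip.
have rL b : b \in rem b0 (level n) -> (b != b0) && (b \in level n).
  by rewrite mem_rem_uniq ?level_uniq // inE.
have fixb0 (s : autC) : fixes n s ->
    {in rem b0 (level n), forall b, s (gam b) = gam b} -> s (gam b0) = gam b0.
  move=> fs fr; apply: contrapT => /eqP nb0; apply: (noflip s); split=> // b bL.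
  case: (eqVneq b b0) => [->//|bb0]; apply/negbTE; rewrite negbK; apply/eqP/fr.
  by rewrite mem_rem_uniq ?level_uniq // inE bb0.
have [||||| J fJ] := @kummer_fixed _ gam (rem b0 (level n)) (fixes n) (gam b0).
- exact: fixes_comp.
- by rewrite rem_uniq ?level_uniq.
- move=> s b fs /rL/andP[_ bL].
  by have := aut_gam s b; rewrite (fs b bL).
- by move=> s fs; have := aut_gam s b0; rewrite (fs b0 b0L).
- exact: fixb0.
pose J1 b := (b == b0) || J b.
have pJ1 : \prod_(b <- level n | J1 b) gam b =
    gam b0 * \prod_(b <- rem b0 (level n) | J b) gam b.
  rewrite (perm_big _ (perm_to_rem b0L)) big_cons /J1 eqxx /=; congr (_ * _).
  rewrite big_seq_cond [RHS]big_seq_cond; apply: eq_bigl => b.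
  by case bL: (b \in rem _ _) => //=; have /andP[/negPf-> _] := rL b bL.
have aJ1 : annihilates n J1.
  move=> s fs; have := neg_prod J1 fs; rewrite pJ1 fJ // -pJ1.
  set P := \prod_(_ <- _ | _) _.
  have P0 : P != 0.
    rewrite /P prodf_seq_neq0; apply/allP => b bL.
    by rewrite (gam_neq0 bL) implybT.
  rewrite -{1}[P]mul1r => /(mulIf P0); case: (\big[_/_]_(_ <- _ | _) _) => //.
  by move/(@signr_inj _ false true).
have aT : annihilates n predT.
  apply: (@annihilates_predT 0 n J1 b0) => //.
  by rewrite /J1 eqxx.
have fD s : fixes n s -> s (disc_root n) = disc_root n.
  by move=> fs; rewrite (neg_prod predT fs) aT // mul1r.
have [I DI] := sqrt_rat_level ind (disc_rootX2 n) fD.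
case/CratP: DI => z Dz; have /eqP := disc_nonsquare n I z; apply.
apply: (fmorph_inj (@ratr algC)).
rewrite rmorphXn /= -Dz exprMn disc_rootX2 rmorphM; congr (_ * _).
rewrite rmorph_prod -prodrXl; apply: eq_bigr => i _.
by rewrite disc_rootX2.
Qed.

(** Compose the flips at the vertices where [e] holds; signs add up under composition. *)
Lemma flips_exist n (e : pred algC) : exists2 t : autC, fixes n t &
  {in level n, forall b, neg t b = e b}.
Proof.
have flipsL (L : seq algC) : {subset L <= level n} -> exists2 t : autC,
    fixes n t & {in level n, forall b, neg t b = e b && (b \in L)}.
  elim: L => [|b0 L IH] sL.
    exists idfun => // b _; rewrite andbF; exact/negbF.
  have [|t ft tE] := IH; first by move=> b bL; apply: sL; rewrite inE bL orbT.
  have [b0f|b0f] := boolP (e b0 && (b0 \notin L)); last first.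
    exists t => // b bL; rewrite tE // inE; case: eqP => [->|//].
    by move: b0f; case: (e b0); case: (b0 \in L).
  case/andP: b0f => eb0 b0L.
  have [|u [fu uE]] := @level_independent n b0; first by rewrite sL ?mem_head.
  exists (u \o t); first exact: fixes_comp.
  move=> b bL; rewrite (neg_comp fu ft bL) uE // tE // inE.
  by case: eqP => [->|//]; rewrite eb0 (negPf b0L).
have [//|t ft tE] := flipsL (level n).
by exists t => // b bL; rewrite tE // bL andbT.
Qed.

(** * Realising a tree map by an automorphism, level by level and then globally *)

Section TreeMap.

Variable T : algC -> algC.
Hypothesis T_root : T (ratr a) = ratr a.
Hypothesis T_inj : forall n, {in level n &, injective T}.
Hypothesis T_fC : forall n, {in level n.+1, forall b, fC (T b) = T (fC b)}.

Lemma aut_agree_levelW m n (s : autC) : (m <= n)%N ->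
  {in level n, s =1 T} -> {in level m, s =1 T}.
Proof.
move=> /subnKC <-; elim: (n - m)%N => [|k IH]; first by rewrite addn0.
rewrite addnS => sT; apply: IH => b bL.
by rewrite -[b]fC_gam aut_fC sT ?mem_gam // (T_fC (mem_gam bL)).
Qed.

(** An automorphism agreeing with [T] on level [n] is off by signs on the next level; precompose it
    with one that fixes level [n] and has exactly these signs. *)
Lemma aut_agree_level n : exists s : autC, {in level n, s =1 T}.
Proof.
elim: n => [|n [s sT]].
  by exists idfun => b; rewrite inE => /eqP->; rewrite T_root.
have Tg x : x \in level n.+1 -> T x = s x \/ T x = - s x.
  move=> xL; apply: fC_eq; rewrite (T_fC xL) -aut_fC sT //.
  by rewrite -mem_levelS.
have [t ft tE] := flips_exist n (fun b => T (gam b) != s (gam b)).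
exists (s \o t).
have stg b : b \in level n -> s (t (gam b)) = T (gam b).
  move=> bL; rewrite (neg_sign ft bL) tE //.
  case: eqP => [->|ne]; first by rewrite mul1r.
  by case: (Tg _ (mem_gam bL)) => // ->; rewrite mulN1r rmorphN.
move=> x; rewrite mem_levelS => fxL /=.
case: (gam_fC x) => ->; first exact: stg.
rewrite !rmorphN /= stg //.
have gL := mem_gam fxL; have gLN : - gam (fC x) \in level n.+1 by rewrite mem_levelN.
(* Both values are [s (gam (fC x))] up to sign, so being distinct they are opposite. *)
have : T (- gam (fC x)) != T (gam (fC x)).
  by apply/eqP => /(T_inj gLN gL)/eqP; rewrite (gam_neqN fxL).
case: (Tg _ gL) => ->; case: (Tg _ gLN) => ->; rewrite rmorphN ?opprK ?eqxx //.
Qed.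

Lemma aut_agree : exists g : autC, forall n, {in level n, g =1 T}.
Proof.
have [sg sgT] := choice aut_agree_level.
have [g gE] := aut_ultralimit sg; exists g => n b bL.
by apply: (gE b _ n) => m nm; exact: aut_agree_levelW (sgT m) b bL.
Qed.

End TreeMap.

End QuadraticTree.

(** * Arithmetic of the critical orbit *)

Lemma square_even_logn m : (0 < m)%N ->
  (forall p, prime p -> ~~ odd (logn p m)) -> exists w, m = (w ^ 2)%N.
Proof.
move=> m0 ev; exists (\prod_(0 <= p < m.+1) p ^ (logn p m)./2)%N.
rewrite -{1}(partnT m0) (widen_partn _ (leqnn m)).
rewrite (big_morph (expn^~ 2) (fun x y => expnMn x y 2) (exp1n 2)).
apply: eq_bigr => p _; rewrite -expnM muln2 -[LHS]/(p ^ _)%N; congr (_ ^ _)%N.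
case: (boolP (prime p)) => [/ev/even_halfK-> //|np].
by rewrite lognE (negPf np).
Qed.

(** * A polynomial recursion for the critical orbit, usable over the integers and over finite
    fields *)

Section Numerators.

Variable R : comNzRingType.
Variables r s : R.

Definition num0 : R := - s ^+ 2 + r * s - r ^+ 2.

(** This is [s ^ (2 ^ n.+1 - 1)]; for [a = r / s] it makes [crit n] equal to
    [num n / (s * den n)]. *)
Fixpoint den n : R := if n is m.+1 then den m ^+ 2 * s else s.

Fixpoint num n : R := if n is m.+1 then num m ^+ 2 + num0 * den m ^+ 2 else num0.

(** For [a = r / s] this is [disc n] times the square [s ^ (2 ^ n.+1)]. *)
Definition dnum n : R := if n is 0%N then s ^+ 2 + r ^+ 2 else num n - r * den n.

(** It clears denominators in [crit n.+1 - a = crit n ^+ 2 - (a - c)], where [a - c = 1 + a ^+ 2].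
    The congruences excluding minus a square start from this form. *)
Lemma dnumS n : dnum n.+1 = num n ^+ 2 - (s ^+ 2 + r ^+ 2) * den n ^+ 2.
Proof. rewrite /= /num0; ring. Qed.

End Numerators.

Section NumeratorsMorphism.

Variables (R R' : comNzRingType) (h : {rmorphism R -> R'}) (r s : R).

Lemma rmorph_den n : h (den s n) = den (h s) n.
Proof. by elim: n => //= n <-; rewrite rmorphM rmorphXn. Qed.

Lemma rmorph_num n : h (num r s n) = num (h r) (h s) n.
Proof.
have h0 : h (num0 r s) = num0 (h r) (h s).
  by rewrite /num0 rmorphB rmorphD rmorphN !rmorphXn rmorphM.
by elim: n => //= n <-; rewrite rmorphD !rmorphXn rmorphM !rmorphXn h0 rmorph_den.
Qed.

Lemma rmorph_dnum n : h (dnum r s n) = dnum (h r) (h s) n.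
Proof.
case: n => [|n]; first by rewrite rmorphD !rmorphXn.
by rewrite rmorphB rmorphM rmorph_num rmorph_den.
Qed.

End NumeratorsMorphism.

Section NumeratorsField.

Variable K : fieldType.
Variables r s : K.

Lemma den0 n : s = 0 -> den s n = 0.
Proof. by move=> s0; case: n => //= n; rewrite s0 mulr0. Qed.

Lemma den_neq0 n : s != 0 -> den s n != 0.
Proof. by move=> s0; elim: n => //= n IH; rewrite mulf_neq0 ?expf_neq0. Qed.

Lemma num_neq0 n : s = 0 -> r != 0 -> num r s n != 0.
Proof.
move=> s0 r0; elim: n => [|n IH] /=.
  by rewrite /num0 s0 expr0n mulr0 oppr0 !add0r oppr_eq0 expf_neq0.
by rewrite (den0 _ s0) expr0n mulr0 addr0 expf_neq0.
Qed.

Lemma dnum_neq0 n : s = 0 -> r != 0 -> dnum r s n != 0.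
Proof.
move=> s0 r0; case: n => [|n]; first by rewrite /= s0 expr0n add0r expf_neq0.
by rewrite /dnum (den0 _ s0) mulr0 subr0 num_neq0.
Qed.

(* With [a = r / s]: the critical orbit hits [a] at the first zero and alternates
   between [a - 1] and [- a] from then on, so the second zero forces [2 a = 0]. *)
Lemma dnum_coprime i j : (i < j)%N -> s != 0 ->
  dnum r s i = 0 -> dnum r s j = 0 -> r *+ 2 = 0.
Proof.
move=> ij s0 Mi Mj.
have Fi : num r s i = r * den s i.
  case: i Mi {ij} => [/=|i] /eqP; last by rewrite subr_eq0 => /eqP.
  by rewrite addr_eq0 /num0 => /eqP e; rewrite e; ring.
have orbit k : num r s (i + k.+1) = (r - s) * den s (i + k.+1) \/
               num r s (i + k.+1) = - r * den s (i + k.+1).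
  elim: k => [|k [IH|IH]]; rewrite addnS /=.
  - by left; rewrite !addn0 Fi /num0; ring.
  - by right; rewrite IH /num0; ring.
  - by left; rewrite IH /num0; ring.
have jE : j = (i + (j - i.+1).+1)%N by lia.
have dj := den_neq0 j s0; have := orbit (j - i.+1)%N; rewrite -jE.
case: j {jE} ij Mj dj => // j _.
rewrite -[dnum _ _ _]/(num r s j.+1 - r * den s j.+1).
move: (num r s j.+1) (den s j.+1) => N D /eqP; rewrite subr_eq0 => /eqP -> dj.
case=> /(mulIf dj)/eqP; rewrite -subr_eq0.
  by rewrite opprB addrCA subrr addr0 (negPf s0).
by rewrite opprK -mulr2n => /eqP.
Qed.

End NumeratorsField.

Lemma dvdz_Fp (p : nat) (m : int) : prime p -> (p%:Z %| m)%Z = (m%:~R == 0 :> 'F_p).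
Proof. by move=> pp; rewrite (dvdz_pcharf (pchar_Fp pp)). Qed.

(** If [x ^+ 2 = -1] then [x ^+ 4 = 1], so [x = x ^+ q = x ^+ 3 = - x], which forces [x = 0] as [q]
    is odd. *)
Lemma sqrtN1_Fp q (x : 'F_q) : prime q -> (q = 3 %[mod 4])%N -> x ^+ 2 != -1.
Proof.
move=> pq q3; apply/eqP => x2.
have x4 : x ^+ 4 = 1 by rewrite (exprM x 2 2) x2 sqrrN expr1n.
have qE : q = (4 * (q %/ 4) + 3)%N by rewrite {1}(divn_eq q 4) q3 mulnC.
have xq : x ^+ (4 * (q %/ 4) + 3) = x.
  by rewrite -qE; have := expf_card x; rewrite card_Fp.
move: xq; rewrite exprD exprM x4 expr1n mul1r exprS x2 mulrN1 => /eqP.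
rewrite eq_sym -subr_eq0 opprK -mulr2n -mulr_natr.
rewrite mulf_eq0 => /orP[/eqP x0|].
  by move: x2; rewrite x0 expr0n => /esym/eqP; rewrite oppr_eq0 oner_eq0.
rewrite -[2%:R]/(2%:Z%:~R) -dvdz_Fp // dvdzE /= => /dvdn_leq.
by have := prime_gt1 pq; lia.
Qed.

Lemma odd_sqr_mod8 (x y : int) : x = 2 * y + 1 -> exists u, x ^+ 2 = 1 + 8 * u.
Proof.
move=> ->; have [u yE] : exists u, y * (y + 1) = 2 * u.
  have [m [-> | ->]] : exists m, y = 2 * m \/ y = 2 * m + 1.
    by exists (y %/ 2)%Z; lia.
  - by exists (m * (2 * m + 1)); ring.
  - by exists ((2 * m + 1) * (m + 1)); ring.
exists u; have -> : (2 * y + 1) ^+ 2 = 4 * (y * (y + 1)) + 1 by ring.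
by rewrite yE; ring.
Qed.

(** The map exchanges [a - 1] and [- a], and [c ^+ 2 + c < 0]; so it sends [[c, a - 1)] into
    [(- a, 0]] and back, and both intervals lie below [a]. *)
Lemma crit_lt (a : rat) n : 0 < a < 1 -> crit (-1 + a - a ^+ 2) n < a.
Proof.
move=> /andP[a0 a1]; set c := -1 + a - a ^+ 2.
have cE : c = -1 + a - a ^+ 2 by [].
suff : (c <= crit c n < a - 1) \/ (- a < crit c n <= 0).
  by move=> [] /andP[]; lra.
have a2 : 0 < a ^+ 2 by rewrite exprn_gt0.
have c1 : 0 < c + 1.
  have -> : c + 1 = a * (1 - a) by rewrite cE; ring.
  by rewrite mulr_gt0 // subr_gt0.
elim: n => [|n IH]; rewrite /crit /= -/(crit c _).
  by left; rewrite cE; lra.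
move: (crit c n) IH => x [] /andP[x1 x2]; [right|left]; apply/andP; split.
- have h1 : 0 < a - 1 - x by lra.
  have h2 : 0 < 1 - a - x by lra.
  by have := mulr_gt0 h1 h2; lra.
- have h1 : 0 <= x - c by lra.
  have h2 : 0 <= - x - c by lra.
  have h3 : 0 < - c by lra.
  by have := mulr_ge0 h1 h2; have := mulr_gt0 h3 c1; lra.
- by rewrite lerDr sqr_ge0.
- have h1 : 0 < a - x by lra.
  have h2 : 0 < a + x by lra.
  by have := mulr_gt0 h1 h2; lra.
Qed.

Section Arithmetic.

Variables (r s : int).
Let a : rat := r%:~R / s%:~R.
Let c : rat := -1 + a - a ^+ 2.

Hypothesis s_gt0 : 0 < s.

(** This is [s ^ (2 ^ n)]. *)
Definition den_sqrt n : int := if n is m.+1 then s * den s m else s.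

Lemma den_sqrtE n : s * den s n = den_sqrt n ^+ 2.
Proof. by case: n => //= n; ring. Qed.

Lemma den_int_neq0 n : den s n != 0.
Proof.
by elim: n => [|n IH] /=; rewrite ?mulf_neq0 ?expf_neq0 // gt_eqF.
Qed.

Lemma den_sqrt_neq0 n : den_sqrt n != 0.
Proof. by case: n => [|n] /=; rewrite ?mulf_neq0 ?den_int_neq0 // gt_eqF. Qed.

Let intrQ0 (x : int) : x != 0 -> x%:~R != 0 :> rat.
Proof. by rewrite intr_eq0. Qed.

Lemma critE n : crit c n = (num r s n)%:~R / (s * den s n)%:~R.
Proof.
have s0 : s%:~R != 0 :> rat by rewrite intr_eq0 gt_eqF.
elim: n => [|n IH].
  by rewrite /crit /= /c /a /num0; field.
have d0 := intrQ0 (den_int_neq0 n).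
rewrite /crit /= -/(crit c n) IH /c /a /num0.
by field; rewrite s0 d0.
Qed.

Lemma discE n : disc a c n = (dnum r s n)%:~R / (den_sqrt n)%:~R ^+ 2.
Proof.
have s0 : s%:~R != 0 :> rat by rewrite intr_eq0 gt_eqF.
case: n => [|n].
  by rewrite /= /c /a; field.
have d0 := intrQ0 (den_int_neq0 n.+1).
rewrite -rmorphXn -den_sqrtE /disc critE /a /dnum.
by field; rewrite s0 d0.
Qed.

Hypothesis r_gt0 : 0 < r.
Hypothesis r_lt_s : r < s.
Hypothesis r_odd_prime : forall p, prime p -> odd p -> r%:~R != 0 :> 'F_p.
Hypothesis dnum_even_logn2 : forall n, ~~ odd (logn 2 `|dnum r s n|).
Hypothesis dnum_neqN_sqr : forall n (w : int), dnum r s n.+1 <> - w ^+ 2.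
Hypothesis disc0_nonsquare : ~ exists b : rat, a - c = b ^+ 2.

Lemma dnum_lt0 n : dnum r s n.+1 < 0.
Proof.
have a01 : 0 < a < 1.
  by rewrite /a divr_gt0 ?ltr0z //= ltr_pdivrMr ?ltr0z // mul1r ltr_int.
have : disc a c n.+1 < 0 by rewrite subr_lt0; exact: crit_lt.
rewrite discE pmulr_llt0 ?ltrz0 // invr_gt0.
by rewrite exprn_even_gt0 // intr_eq0 den_sqrt_neq0.
Qed.

Lemma dnum_int_neq0 n : dnum r s n != 0.
Proof.
case: n => [|n]; last by rewrite lt_eqF ?dnum_lt0.
by rewrite /= gt_eqF // addr_gt0 // exprn_gt0.
Qed.

(** If [p] divides [s], no [dnum] vanishes modulo [p] because [r] does not; otherwise two zeros
    would give [2 r = 0] modulo [p]. *)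
Lemma dnum_odd_prime p i j : prime p -> odd p -> (i < j)%N ->
  (p%:Z %| dnum r s i)%Z -> (p%:Z %| dnum r s j)%Z -> False.
Proof.
move=> pp op ij; rewrite !dvdz_Fp // !rmorph_dnum => /eqP Mi /eqP Mj.
have r0 := r_odd_prime pp op.
have s0 : s%:~R != 0 :> 'F_p.
  by apply/eqP => s0; have := dnum_neq0 i s0 r0; rewrite Mi eqxx.
have /eqP := dnum_coprime ij s0 Mi Mj.
rewrite -mulr_natr mulf_eq0 (negPf r0) /= -[2%:R]/(2%:Z%:~R) -dvdz_Fp // dvdzE /=.
by rewrite dvdn_prime2 // => /eqP pE; rewrite pE in op.
Qed.

(* Odd primes divide at most one factor of the product, so [- dnum n] would itself
   be a square as soon as it occurs in a square product. *)
Lemma disc_prod_nonsquare n (I : pred nat) z :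
  disc a c n * \prod_(i < n | I i) disc a c i != z ^+ 2.
Proof.
case: n => [|n].
  rewrite big_ord0 mulr1; apply/eqP => e; apply: disc0_nonsquare.
  by exists z.
apply/eqP => e.
pose P : int := \prod_(i < n.+1 | I i) dnum r s i.
have P0 : P != 0 by apply/prodf_neq0 => i _; exact: dnum_int_neq0.
have M0 := dnum_int_neq0 n.+1.
have discM i : disc a c i * (den_sqrt i)%:~R ^+ 2 = (dnum r s i)%:~R.
  by rewrite discE mulfVK // expf_neq0 // intr_eq0 den_sqrt_neq0.
(* The denominators are squares, so the relation passes to the integers [dnum]; comparing valuations
   below then needs only parity. *)
have [y yE] : exists y : rat, (dnum r s n.+1 * P)%:~R = y ^+ 2.
  exists (z * ((den_sqrt n.+1)%:~R * \prod_(i < n.+1 | I i) (den_sqrt i)%:~R)).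
  rewrite [LHS]rmorphM rmorph_prod exprMn -e exprMn -prodrXl mulrACA discM.
  rewrite -big_split; congr (_ * _); apply: eq_bigr => i _; exact/esym/discM.
have {}yE : dnum r s n.+1 * P * denq y ^+ 2 = numq y ^+ 2.
  apply: (@intr_inj rat); rewrite intrM yE !rmorphXn -exprMn /=.
  by rewrite -{1}[y]divq_num_den mulfVK // intr_eq0 denq_neq0.
have ev p : ~~ odd (logn p (`|dnum r s n.+1| * `|P|)).
  have /(congr1 (logn p \o absz)) := yE; rewrite /= [in LHS]abszM !abszX abszM.
  rewrite lognM ?lognX ?muln_gt0 ?expn_gt0 ?absz_gt0 ?M0 ?P0 ?denq_neq0 // => e2.
  by have := congr1 odd e2; rewrite oddD !oddM /= addbF => ->.
have [||w wE] := @square_even_logn `|dnum r s n.+1|.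
- by rewrite absz_gt0.
- move=> p pp; case: (boolP (odd p)) => [op|]; last first.
    by move=> np; have := prime_oddPn pp np => ->; exact: dnum_even_logn2.
  case: (boolP (p%:Z %| dnum r s n.+1)%Z) => [pM|]; last first.
    by rewrite dvdzE /= => np; rewrite lognE pp absz_gt0 M0 (negPf np).
  (* [p] already divides [dnum n.+1], so it divides none of the earlier factors. *)
  have pP : logn p `|P| = 0%N.
    apply/eqP; rewrite lognE pp absz_gt0 P0 /=; case: ifP => // pP.
    suff : ~~ (p%:Z %| P)%Z by rewrite dvdzE /= pP.
    rewrite /P; elim/big_ind: _ => [|x1 x2|i _].
    + by rewrite dvdzE /= dvdn1; case: eqP pp => // ->.
    + by rewrite !dvdzE abszM /= Euclid_dvdM // negb_or => -> ->.
    + by apply/negP => /(dnum_odd_prime pp op (ltn_ord i)); apply.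
  by have := ev p; rewrite lognM ?absz_gt0 ?M0 ?P0 // pP addn0.
(* The absolute value is the square of [w] and [dnum n.+1] is negative. *)
have := dnum_neqN_sqr (n := n) (w := w%:Z); apply.
have := dnum_lt0 n; move: wE; move: (dnum r s n.+1) => M wE M_lt0.
by rewrite -[M]opprK -(ltr0_norm M_lt0) -abszE wE expr2 -PoszM mulnn.
Qed.

End Arithmetic.

Lemma logn2_odd (y : int) : logn 2 `|2 * y + 1| = 0%N.
Proof.
by rewrite lognE; case: ifP => // /and3P[_ _]; lia.
Qed.

(** * Numerator 1 and even denominator: congruences modulo 2 and 4 *)

Section EvenDenominator.

Variables s k : int.
Hypothesis sE : s = 2 * k.

Lemma dnum1_even_logn2 n : ~~ odd (logn 2 `|dnum 1 s n|).
Proof.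
have s0 : s%:~R = 0 :> 'F_2 by apply/eqP; rewrite -dvdz_Fp //; lia.
have := @dnum_neq0 'F_2 1%:~R s%:~R n s0 (oner_neq0 _).
rewrite -rmorph_dnum -dvdz_Fp //.
by rewrite dvdzE lognE => /negPf ->; rewrite andbF.
Qed.

Lemma den_even n : exists x, den s n = 2 * x.
Proof.
by case: n => [|n]; [exists k|exists (den s n ^+ 2 * k); rewrite /= sE; ring].
Qed.

Lemma num1_odd n : exists y, num 1 s n = 2 * y + 1.
Proof.
elim: n => [|n [y IH]] /=.
  by exists (- 2 * k ^+ 2 + k - 1); rewrite /num0 sE; ring.
have [x ->] := den_even n; rewrite IH.
by exists (2 * y ^+ 2 + 2 * y + 2 * num0 1 s * x ^+ 2); ring.
Qed.

(** An odd square minus a multiple of 4 is 1 modulo 4, while minus a square is 0 or 3. *)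
Lemma dnum1_neqN_sqr n (w : int) : dnum 1 s n.+1 <> - w ^+ 2.
Proof.
rewrite dnumS; have [x ->] := den_even n; have [y ->] := num1_odd n.
have [v [->|->]] : exists v, w = 2 * v \/ w = 2 * v + 1.
  by exists (w %/ 2)%Z; lia.
- have -> : (2 * y + 1) ^+ 2 - (s ^+ 2 + 1 ^+ 2) * (2 * x) ^+ 2 =
    4 * (y ^+ 2 + y - (s ^+ 2 + 1) * x ^+ 2) + 1 by ring.
  have -> : (2 * v) ^+ 2 = 4 * v ^+ 2 by ring.
  by move: (_ - _ * _) (v ^+ 2) => A B; lia.
- have -> : (2 * y + 1) ^+ 2 - (s ^+ 2 + 1 ^+ 2) * (2 * x) ^+ 2 =
    4 * (y ^+ 2 + y - (s ^+ 2 + 1) * x ^+ 2) + 1 by ring.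
  have -> : (2 * v + 1) ^+ 2 = 4 * (v ^+ 2 + v) + 1 by ring.
  by move: (_ - _ * _) (v ^+ 2 + v) => A B; lia.
Qed.

End EvenDenominator.

(** * Numerator 2 and odd denominator: 2-adic valuations *)

Section OddDenominator.

Variables s k : int.
Hypothesis sE : s = 2 * k + 1.

Lemma den_mod8 n : exists x, den s n = s + 8 * x.
Proof.
elim: n => [|n [x IH]] /=; first by exists 0; rewrite mulr0 addr0.
have [|u ->] := @odd_sqr_mod8 (den s n) (k + 4 * x); first by rewrite IH sE; ring.
by exists (u * s); ring.
Qed.

(** The two cases alternate along the orbit. Modulo 8 is the precision required: subtracting
    [2 * den] in the even case leaves 4 modulo 8, of valuation exactly 2. *)
Lemma num2_mod8 n : (exists y, num 2 s n = 2 * s + 4 + 8 * y) \/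
  (exists y, num 2 s n = 2 * y + 1).
Proof.
have [u s2] := odd_sqr_mod8 sE.
have n0 : num0 2 s = 2 * s - 5 - 8 * u by rewrite /num0 s2; ring.
elim: n => [|n IH] /=.
  by right; exists (s - 3 - 4 * u); rewrite n0; ring.
have [x dE] := den_mod8 n.
have [|v ->] := @odd_sqr_mod8 (den s n) (k + 4 * x); first by rewrite dE sE; ring.
rewrite n0; case: IH => -[y yE].
  have [|w wE] := @odd_sqr_mod8 (s + 2 + 4 * y) (k + 1 + 2 * y).
    by rewrite sE; ring.
  right; exists (s - 1 + 4 * (4 * w - u + (2 * s - 5 - 8 * u) * v)).
  have -> : num 2 s n = 2 * (s + 2 + 4 * y) by rewrite yE; ring.
  by rewrite exprMn wE; ring.
have [w ->] := odd_sqr_mod8 yE.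
by left; exists (w - u + (2 * s - 5 - 8 * u) * v - 1); ring.
Qed.

Lemma dnum2_even_logn2 n : ~~ odd (logn 2 `|dnum 2 s n|).
Proof.
case: n => [|n].
  have [u s2] := odd_sqr_mod8 sE; rewrite /dnum s2.
  have -> : 1 + 8 * u + 2 ^+ 2 = 2 * (4 * u + 2) + 1 by ring.
  by rewrite logn2_odd.
rewrite /dnum; have [x ->] := den_mod8 n.+1.
case: (num2_mod8 n.+1) => -[y ->].
  have -> : 2 * s + 4 + 8 * y - 2 * (s + 8 * x) = 4 * (2 * (y - 2 * x) + 1) by ring.
  rewrite abszM lognM ?logn2_odd //; lia.
have -> : 2 * y + 1 - 2 * (s + 8 * x) = 2 * (y - s - 8 * x) + 1 by ring.
by rewrite logn2_odd.
Qed.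

End OddDenominator.

(** * Numerator 2 and denominator 1 modulo 3 *)

Section DenominatorOneMod3.

Variables s k : int.
Hypothesis sE : s = 3 * k + 1.

Lemma den_mod3 n : exists x, den s n = 3 * x + 1.
Proof.
elim: n => [|n [x IH]] /=; first by exists k.
exists ((3 * x ^+ 2 + 2 * x) * s + k).
by rewrite IH {2}sE sE; ring.
Qed.

Lemma num2_mod3 n : exists y, num 2 s n = 3 * y.
Proof.
have n0 : num0 2 s = 3 * (- 3 * k ^+ 2 - 1) by rewrite /num0 sE; ring.
elim: n => [|n [y IH]] /=; first by exists (- 3 * k ^+ 2 - 1).
exists (3 * y ^+ 2 + (- 3 * k ^+ 2 - 1) * den s n ^+ 2).
by rewrite IH n0; ring.
Qed.

(** Here [c], hence each [num], is 0 modulo 3, so [dnum n.+1] is congruent to [- (1 + 4)], that is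
    1, whereas minus a square is 0 or 2. *)
Lemma dnum2_neqN_sqr_mod3 n (w : int) : dnum 2 s n.+1 <> - w ^+ 2.
Proof.
rewrite dnumS; have [x ->] := den_mod3 n; have [y ->] := num2_mod3 n.
have -> : (3 * y) ^+ 2 - (s ^+ 2 + 2 ^+ 2) * (3 * x + 1) ^+ 2 =
    3 * (3 * y ^+ 2 - (s ^+ 2 + 4) * (3 * x ^+ 2 + 2 * x) - 3 * k ^+ 2 - 2 * k - 2) + 1.
  by rewrite sE; ring.
move: (_ - 2) => A.
have [v] : exists v, [\/ w = 3 * v, w = 3 * v + 1 | w = 3 * v + 2].
  exists (w %/ 3)%Z; have [e|[e|e]] : (w %% 3)%Z = 0 \/ (w %% 3)%Z = 1 \/
      (w %% 3)%Z = 2 by lia.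
  - by constructor 1; lia.
  - by constructor 2; lia.
  - by constructor 3; lia.
have e0 : (3 * v) ^+ 2 = 3 * (3 * v ^+ 2) by ring.
have e1 : (3 * v + 1) ^+ 2 = 3 * (3 * v ^+ 2 + 2 * v) + 1 by ring.
have e2 : (3 * v + 2) ^+ 2 = 3 * (3 * v ^+ 2 + 4 * v + 1) + 1 by ring.
case=> ->; rewrite ?e0 ?e1 ?e2.
- by move: (3 * v ^+ 2) => B; lia.
- by move: (3 * v ^+ 2 + _) => B; lia.
- by move: (3 * v ^+ 2 + _ + _) => B; lia.
Qed.

End DenominatorOneMod3.

(** Modulo [q] the denominators vanish, so [dnum n.+1] is the nonzero square [num n ^+ 2]; were it
    also minus a square, [-1] would be a square modulo [q]. *)
Lemma dnum_neqN_sqr_modq (r s : int) (q : nat) n (w : int) :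
  prime q -> (q = 3 %[mod 4])%N -> (q%:Z %| s)%Z -> r%:~R != 0 :> 'F_q ->
  dnum r s n.+1 <> - w ^+ 2.
Proof.
move=> pq q3; rewrite dvdz_Fp // => /eqP s0 r0 e.
have N0 := num_neq0 n s0 r0.
have : (num r%:~R s%:~R n : 'F_q) ^+ 2 = - w%:~R ^+ 2.
  have := congr1 (intr : int -> 'F_q) e; rewrite rmorph_dnum dnumS (den0 _ s0).
  by rewrite expr0n mulr0 subr0 rmorphN rmorphXn.
move=> e2; have /eqP := @sqrtN1_Fp q (w%:~R / num r%:~R s%:~R n) pq q3; apply.
by rewrite expr_div_n e2 invrN mulrN divff // -oppr_eq0 -e2 expf_neq0.
Qed.

(** * Surjectivity *)

Section Surjectivity.

Variables a c : rat.
Let f : {poly rat} := 'X^2 + c%:P.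

Hypothesis a_aperiodic : forall n, iter n.+1 (fC c) (ratr a) <> ratr a.
Hypothesis disc_nonsquare : forall n (I : pred nat) z,
  disc a c n * \prod_(i < n | I i) disc a c i != z ^+ 2.

Lemma evalC_fC : evalC f =1 fC c.
Proof.
by move=> z; rewrite /evalC rmorphD /= map_polyXn map_polyC /= !hornerE.
Qed.

Lemma level_orbit n b : b \in level a c n -> b \in backward_orbit f a.
Proof.
rewrite mem_level => /eqP bL; apply: mem_set; exists n.
by rewrite (eq_iter evalC_fC).
Qed.

Lemma orbit_level (v : vertex f a) : exists n, val v \in level a c n.
Proof.
have /set_mem[n vn] := valP v; exists n.
by rewrite mem_level -(eq_iter evalC_fC) vn.
Qed.

Lemma level_unique m n b : b \in level a c m -> b \in level a c n -> m = n.
Proof.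
wlog mn : m n / (m <= n)%N.
  move=> H bm bn; case/orP: (leq_total m n) => mn; first exact: H.
  by apply/esym/H.
rewrite !mem_level -(subnK mn) iterD => /eqP->.
by case: (n - m)%N => // k /eqP/a_aperiodic.
Qed.

Lemma root_fC_notin : fC c (ratr a) \notin backward_orbit f a.
Proof.
apply/negP => /set_mem[n]; rewrite (eq_iter evalC_fC) -iterSr.
exact: a_aperiodic.
Qed.

Section Automorphism.

Variable t : aut_tree f a.

(** [t] as a total function on [algC]; points off the backward orbit are treated as the root. *)
Definition tree_fun z : algC := val (t (insubd (root_vertex f a) z)).

Lemma tree_funE (v : vertex f a) : tree_fun (val v) = val (t v).
Proof. by rewrite /tree_fun valKd. Qed.

Lemma tree_fun_root : tree_fun (ratr a) = ratr a.
Proof.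
by rewrite -[ratr a]/(val (root_vertex f a)) tree_funE aut_root.
Qed.

Lemma tree_fun_orbit z : tree_fun z \in backward_orbit f a.
Proof. exact: valP. Qed.

Lemma tree_fun_inj : {in backward_orbit f a &, injective tree_fun}.
Proof.
move=> x y xO yO /val_inj/(bij_inj (aut_bij t))/(congr1 val).
by rewrite !insubdK.
Qed.

Lemma tree_fun_adj x : x \in backward_orbit f a -> fC c x \in backward_orbit f a ->
  fC c (tree_fun x) = tree_fun (fC c x) \/ fC c (tree_fun (fC c x)) = tree_fun x.
Proof.
move=> xO fxO; rewrite -!evalC_fC in fxO *.
pose v := insubd (root_vertex f a); have [adj _] := aut_adj t (v x) (v (evalC f x)).
by apply: adj; left; rewrite !insubdK.
Qed.

(** Adjacency is unoriented, so [t] could a priori reverse an edge. At the root this would put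
    [f(a)] in the backward orbit; higher up, injectivity would identify [b] with [f(f(b))], two
    levels lower. *)
Lemma tree_fun_fC n :
  {in level a c n.+1, forall b, fC c (tree_fun b) = tree_fun (fC c b)}.
Proof.
elim: n => [|n IH] b bL; have fbL := bL; rewrite mem_levelS in fbL;
  case: (tree_fun_adj (level_orbit bL) (level_orbit fbL)) => // e.
  move: e root_fC_notin; have -> : fC c b = ratr a by apply/eqP; rewrite inE in fbL.
  by rewrite tree_fun_root => ->; rewrite tree_fun_orbit.
have ffbL := fbL; rewrite mem_levelS in ffbL.
move: e; rewrite IH // => /(tree_fun_inj (level_orbit ffbL) (level_orbit bL)) e.
by rewrite e in ffbL; have := level_unique bL ffbL; lia.
Qed.

End Automorphism.

Lemma arboreal_surjective (t : aut_tree f a) :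
  exists g : abs_gal, arboreal_rep f a g = t.
Proof.
(* The empty product and [z = 0] in [disc_nonsquare]. *)
have disc_neq0 n : disc a c n != 0.
  have := disc_nonsquare n pred0 0.
  by rewrite big_pred0 // mulr1 expr0n.
have [||g gT] := aut_agree disc_neq0 disc_nonsquare (tree_fun_root t).
- by move=> n x y /level_orbit xO /level_orbit yO; exact: tree_fun_inj.
- exact: tree_fun_fC.
have gb : bijective g := Bijective (algC_autK g) (algC_invautK g).
exists (AbsGal gb (fmorph_rat g)); apply: rooted_aut_ext => v; apply: val_inj => /=.
by have [n vL] := orbit_level v; rewrite (gT n) // tree_funE.
Qed.

End Surjectivity.

(** After one step the orbit of [a] alternates between [a - 1] and [- a]. *)
Lemma iter_preperiodic (a : rat) n : a != 0 ->
  iter n.+1 (fC (-1 + a - a ^+ 2)) (ratr a) <> ratr a.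
Proof.
move=> a0; pose f (x : rat) := x ^+ 2 + (-1 + a - a ^+ 2).
have fCE m : iter m (fC (-1 + a - a ^+ 2)) (ratr a) = ratr (iter m f a).
  by elim: m => //= m ->; rewrite /fC -rmorphXn -rmorphD.
rewrite fCE => /fmorph_inj; have : iter n.+1 f a = a - 1 \/ iter n.+1 f a = - a.
  elim: n => [|n [] IH].
  - by left; rewrite /= /f; ring.
  - by right; rewrite iterS IH /f; ring.
  - by left; rewrite iterS IH /f; ring.
by move=> [] -> e; move: a0; lra.
Qed.

Theorem theorem1p2 (a c : rat) (f : {poly rat}) (r s : int)
  (hc : c = -1 + a - a ^+ 2)
  (hf : f = 'X^2 + c%:P)
  (hs : 0 < s)
  (hrs : gcdz r s = 1)
  (ha : a = r%:~R / s%:~R)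
  (hsq : ~ exists b : rat, a - c = b ^+ 2)
  (hcases :
     [\/ [/\ r = 1, 2 < s & (2 %| s)%Z],
         [/\ r = 2, 3 < s & (s = 1 %[mod 3])%Z]
       | r = 2 /\ exists q : nat, [/\ prime q, (q = 3 %[mod 4])%N & (q%:Z %| s)%Z]]) :
  forall t : aut_tree f a, exists g : abs_gal, arboreal_rep f a g = t.
Proof.
have two_Fp p : prime p -> odd p -> (2 : int)%:~R != 0 :> 'F_p.
  move=> pp op; rewrite -dvdz_Fp // dvdzE /= dvdn_prime2 //.
  by apply/eqP => pE; rewrite pE in op.
(* By coprimality with [r = 2]. *)
have s_odd : r = 2 -> s = 2 * (s %/ 2)%Z + 1.
  move=> r2; have : ~~ (2 %| s)%Z by apply/negP => /gcdz_idPl; rewrite -r2 hrs r2.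
  lia.
have r_gt0 : 0 < r by case: hcases => [[->]|[->]|[->]].
have a_neq0 : a != 0.
  by rewrite ha mulf_neq0 ?invr_eq0 ?intr_eq0 ?gt_eqF.
rewrite hf; apply: arboreal_surjective => [n|].
  by rewrite hc; exact: iter_preperiodic.
rewrite hc ha in hsq *.
case: hcases => [[r1 s2 s_even]|[r2 s3 s_mod]|[r2 [q [pq q3 qs]]]].
- have sE : s = 2 * (s %/ 2)%Z by lia.
  apply: disc_prod_nonsquare hsq => //; rewrite r1.
  + by lia.
  + by move=> p _ _; rewrite oner_neq0.
  + exact: dnum1_even_logn2 sE.
  + exact: dnum1_neqN_sqr sE.
- have sE : s = 3 * (s %/ 3)%Z + 1 by lia.
  apply: disc_prod_nonsquare hsq => //; rewrite r2 //.
  + by lia.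
  + exact: dnum2_even_logn2 (s_odd r2).
  + exact: dnum2_neqN_sqr_mod3 sE.
- apply: disc_prod_nonsquare hsq => //; rewrite r2 //.
  (* The bound [r < s] holds since [q], being 3 modulo 4, is at least 3. *)
  + have : (q <= `|s|)%N.
      by apply: dvdn_leq; [rewrite absz_gt0 gt_eqF|rewrite dvdzE in qs].
    by lia.
  + exact: dnum2_even_logn2 (s_odd r2).
  + move=> n w; apply: dnum_neqN_sqr_modq qs _ => //; apply: two_Fp => //.
    by lia.
Qed.
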